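(* Let $d\ge 1$ and $\tilde{J}\in\mathbb{N}$, $\tilde J\ge 1$. Assume $v\in L_0^2(\mathbb{T}^d)$ and $v\neq 0$. For any sequence of maps $g_1(t_1,\cdot),\ldots, g_{\tilde{J}}(t_{\tilde{J}},\cdot):\mathbb{T}^d\to\mathbb{T}^d$, where each $g_j$ is a flow on $\mathbb{T}^d$ and $t_j\in\mathbb{R}$, satisfying $v\circ g_{\tilde{J}}(t_{\tilde{J}},\cdot)\circ\cdots \circ g_{j}(t_{j},\cdot)\in L^2_0(\mathbb{T}^d)$ and $v\circ g_{\tilde{J}}(t_{\tilde{J}},\cdot)\circ\cdots \circ g_{j}(t_{j},\cdot)\neq 0$ for all $j=1,\ldots, \tilde{J}$, and for any $\epsilon>0$, there exist a finite set $N\subset \mathbb{Z}^d\setminus \{0\}$, integers $0<J_1 <\cdots < J_{\tilde{J}}$, and matrices $\mathbf{L}_1,\ldots,\mathbf{L}_{J_{\tilde{J}}}\in T(N,\mathbb{C})$ such that, setting $J_0=0$ and $$\mathbf{G}_j=Q_N\mathrm{e}^{\mathbf{L}_{J_{j-1}+1}}\mathrm{e}^{\mathbf{L}_{J_{j-1}+2}}\cdots \mathrm{e}^{\mathbf{L}_{J_{\tilde{J}}}}Q_N^*v,$$ one has $$\Vert v\circ g_{\tilde{J}}(t_{\tilde{J}},\cdot)\circ \cdots \circ g_j(t_j,\cdot)-\mathbf{G}_j\Vert\le \epsilon\qquad\text{for all } j=1,\ldots,\tilde{J},$$ where $\Vert\cdot\Vert$ is the norm of $L^2(\mathbb{T}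^d)$.
   Context: $\mathbb{T}=\mathbb{R}/2\pi\mathbb{Z}$, and $L^2(\mathbb{T}^d)$ is the space of complex-valued square-integrable functions on $\mathbb{T}^d$ with respect to the normalized Lebesgue measure (total mass $1$). For $n\in\mathbb{Z}^d$ let $q_n(x)=\mathrm{e}^{\mathrm{i}n\cdot x}$, so that $\{q_n\}_{n\in\mathbb{Z}^d}$ is an orthonormal basis. $L_0^2(\mathbb{T}^d)=\overline{\operatorname{Span}\{q_n\mid n\neq 0\}}$ is the subspace of functions with average $0$. Flows: each $g_j:\mathbb{R}\times\mathbb{T}^d\to\mathbb{T}^d$ is the flow of an ODE $\frac{\mathrm{d}x}{\mathrm{d}t}(t)=f_j(x(t))$ on $\mathbb{T}^d$, i.e. $g_j(\cdot,x)$ is the trajectory starting at $x$; it is assumed that $g_j$ is continuous, that each $g_j(t,\cdot)$ is invertible, and that the Jacobian of $g_j(t,\cdot)^{-1}$ is bounded for every $t\in\mathbb{R}$. For a finite set $N\subset\mathbb{Z}^d$, $\mathbb{C}^N$ denotes vectors indexed by $N$ and $\mathbb{C}^{N\times N}$ denotes matrices $[a_{n,l}]_{n,l\in N}$ with rows and columns indexed by $N$. $Q_N:\mathbb{C}^N\to V_N:=\operatorname{Span}\{q_n\mid n\in N\}\subset L^2(\mathbb{T}^d)$ is $Q_Nc=\sum_{n\in N}c_nq_n$, and $Q_N^*:L^2(\mathbb{T}^d)\to\mathbb{C}^N$ is its adjoint, $Q_N^*v=(\langle q_n,v\rangle)_{n\in N}$ (inner product conjugate-linear in the first argument). A matrix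 $A\in\mathbb{C}^{N\times N}$ is called Toeplitz if its $(n,l)$-entry depends only on the difference $n-l\in\mathbb{Z}^d$. For $k=1,\ldots,d$, $D_k\in\mathbb{C}^{N\times N}$ is the diagonal matrix with $(D_k)_{l,l}=\mathrm{i}l_k$, where $l_k$ is the $k$th component of $l\in N\subset\mathbb{Z}^d$. Finally $$T(N,\mathbb{C})=\Big\{\sum_{k=1}^dA_1^{k}\cdots A_{R_k}^{k} D_k\ \Big|\ R_k\in\mathbb{N}\ (R_k\ge 1),\ A_1^{k},\ldots, A_{R_k}^{k}\in\mathbb{C}^{N\times N}\text{ Toeplitz}\ (k=1,\ldots,d)\Big\}.$$ *)

(* Defs.v *)
From HB Require Import structures.
From mathcomp Require Import all_boot all_order all_algebra finmap complex generic_quotient.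
From mathcomp Require Import all_classical all_reals all_analysis.

Set Implicit Arguments.
Unset Strict Implicit.
Unset Printing Implicit Defensive.

Import Order.TTheory GRing.Theory Num.Theory.
Import numFieldNormedType.Exports.

Local Open Scope classical_set_scope.
Local Open Scope ring_scope.
Local Open Scope quotient_scope.

(* R[i] has no topology of its own in the library: use the one of its norm. *)
HB.instance Definition _ (R : realType) :=
  NormedModule.copy R[i] (R[i] : numClosedFieldType).

Section Torus.
Variable R : realType.

Definition circle_equiv (a b : R) : bool :=
  `[< exists m : int, a - b = m%:~R * (2 * pi) >].

Lemma circle_equiv_is_equiv : equiv_class_of circle_equiv.
Proof.
have sym a b : circle_equiv a b -> circle_equiv b a.
  move=> /asboolP[m mE]; apply/asboolP; exists (- m).
  by rewrite -opprB mE mulrNz mulNr.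
split=> [a|a b|b a c].
- by apply/asboolP; exists 0; rewrite subrr mul0r.
- by apply: (sameP idP); apply: (iffP idP); exact: sym.
- move=> /asboolP[m mE] /asboolP[n nE]; apply/asboolP; exists (m + n).
  by rewrite intrD mulrDl -mE -nE addrA subrK.
Qed.

Canonical circle_equiv_rel := EquivRelPack circle_equiv_is_equiv.

Definition circle := quotient_topology {eq_quot circle_equiv_rel}.

HB.instance Definition _ := Topological.on circle.
HB.instance Definition _ := Quotient.on circle.
HB.instance Definition _ := Pointed.on circle.

Definition torus (d : nat) : Type := 'rV[circle]_d.

(* The topology of [torus d] is the product topology. *)
HB.instance Definition _ (d : nat) :=
  PointedTopological.copy (torus d) 'rV[circle]_d.

Definition torus_proj (d : nat) (y : 'rV[R]_d) : torus d :=
  \row_k (\pi_circle (y 0 k) : circle).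

(* [torus d] carries the quotient of the Borel sigma-algebra of [R^d] (which is
   the Borel sigma-algebra of [torus d]). The library puts the Borel
   sigma-algebra of [R^d] on [d.-tuple R]. *)
Definition torus_of_tuple (d : nat) (y : d.-tuple (measurableTypeR R)) :
    torus d :=
  torus_proj (\row_k tnth y k).

Section MeasurableTorus.
Variable d : nat.

Let mtorus (A : set (torus d)) := measurable (@torus_of_tuple d @^-1` A).

Let mtorus0 : mtorus set0.
Proof. by rewrite /mtorus preimage_set0; exact: measurable0. Qed.

Let mtorusC A : mtorus A -> mtorus (~` A).
Proof. by rewrite /mtorus preimage_setC; exact: measurableC. Qed.

Let mtorus_bigcup (F : (set (torus d))^nat) :
  (forall i, mtorus (F i)) -> mtorus (\bigcup_i F i).
Proof. by rewrite /mtorus preimage_bigcup; exact: bigcupT_measurable. Qed.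

HB.instance Definition _ :=
  isMeasurable.Build default_measure_display (torus d)
    mtorus0 mtorusC mtorus_bigcup.

Lemma measurable_torus_of_tuple : measurable_fun setT (@torus_of_tuple d).
Proof. by move=> _ A mA; rewrite setTI. Qed.

HB.instance Definition _ :=
  isMeasurableFun.Build _ _ _ _ (@torus_of_tuple d) measurable_torus_of_tuple.
End MeasurableTorus.

Lemma two_pi_gt0 : 0 < 2 * pi :> R.
Proof. by rewrite mulr_gt0 ?pi_gt0. Qed.

Definition tuple_cons (d : nat)
    (p : measurableTypeR R * d.-tuple (measurableTypeR R)) :
    d.+1.-tuple (measurableTypeR R) := [tuple of p.1 :: p.2].

Lemma measurable_tuple_cons d : measurable_fun setT (@tuple_cons d).
Proof. exact: measurable_cons. Qed.

HB.instance Definition _ d :=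
  isMeasurableFun.Build _ _ _ _ (@tuple_cons d) (@measurable_tuple_cons d).

(* d-fold product of the normalized Lebesgue measure of [0, 2 pi]. *)
Fixpoint cube_measure (d : nat) :
    probability (d.-tuple (measurableTypeR R)) R :=
  if d is d'.+1 then
    distribution (uniform_prob two_pi_gt0 \x cube_measure d')%E (@tuple_cons d')
  else \d_ [tuple].

Definition torus_measure (d : nat) : probability (torus d) R :=
  distribution (cube_measure d) (@torus_of_tuple d).
End Torus.

Lemma periodic_int (R : realType) (f : R -> R) :
  periodic f (pi *+ 2) ->
  forall (a : R) (m : int), f (a + m%:~R * (2 * pi)) = f a.
Proof.
move=> fper; have fpern a (k : nat) : f (a + k%:R * (2 * pi)) = f a.
  elim: k => [|k IH]; first by rewrite mul0r addr0.
  by rewrite -natr1 mulrDl mul1r addrA [2 * pi]mulr_natl fper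
    -[pi *+ 2]mulr_natl.
move=> a [k|k]; first exact: fpern.
by rewrite NegzE -(fpern _ k.+1) mulrNz mulNr subrK.
Qed.

Section L2.
Variables (R : realType) (d : nat).
Local Notation mu := (torus_measure R d).
Implicit Types u v : torus R d -> R[i].

(* Elements of L^2 are given by representatives; [L2norm] is extended-valued, so
   it is +oo, rather than a junk value, on functions that are not in L^2. *)
Definition L2norm v : \bar R :=
  'N[mu]_(2%:E)[EFin \o (fun x => ComplexField.Normc.normc (v x))].

Definition L2dist u v : \bar R := L2norm (fun x => u x - v x).

Definition in_L2 v : Prop :=
  [/\ measurable_fun setT (fun x => complex.Re (v x)),
      measurable_fun setT (fun x => complex.Im (v x)) & (L2norm v < +oo)%E].

Definition zero_in_L2 v : Prop := {ae mu, forall x, v x = 0}.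

Definition inner u v : R[i] :=
  let w x := conjc (u x) * v x in
  (\int[mu]_x complex.Re (w x) +i* \int[mu]_x complex.Im (w x))%C.

(* The exponential is independent of the representatives of the coordinates
   of [x]: see [fourier_modeE]. *)
Definition fourier_mode (n : 'rV[int]_d) (x : torus R d) : R[i] :=
  let theta := \sum_(k < d) (n 0 k)%:~R * repr ((x : 'rV[circle R]_d) 0 k) in
  (cos theta +i* sin theta)%C.

Lemma fourier_modeE n (y : 'rV[R]_d) :
  fourier_mode n (torus_proj y) =
    (cos (\sum_(k < d) (n 0 k)%:~R * y 0 k) +i*
     sin (\sum_(k < d) (n 0 k)%:~R * y 0 k))%C.
Proof.
rewrite /fourier_mode /=; set th := \sum_(k < d) _ * repr _.
suff [m thE] : exists m : int,
    th = \sum_(k < d) (n 0 k)%:~R * y 0 k + m%:~R * (2 * pi).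
  by rewrite thE (periodic_int (@cosD2pi R)) (periodic_int (@sinD2pi R)).
have /choice[m mE] (k : 'I_d) : exists m : int,
    repr ((torus_proj y : 'rV[circle R]_d) 0 k) - y 0 k = m%:~R * (2 * pi).
  apply/asboolP; rewrite mxE -/(circle_equiv _ _).
  by have /eqmodP := reprK (\pi_(circle R) (y 0 k)).
exists (\sum_(k < d) n 0 k * m k).
rewrite rmorph_sum mulr_suml -big_split/=; apply: eq_bigr => k _.
by rewrite rmorphM/= -mulrA -mE mulrBr addrC subrK.
Qed.

Section FiniteModes.
Variable N : {fset 'rV[int]_d}.

(* Rows and columns of matrices indexed by [N] are numbered through the
   enumeration of [N]. *)
Definition mode (i : 'I_#|{: N}|) : 'rV[int]_d := val (enum_val i).

Definition Qmap (c : 'cV[R[i]]_#|{: N}|) : torus R d -> R[i] :=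
  fun x => \sum_i c i 0 * fourier_mode (mode i) x.

Definition Qadj v : 'cV[R[i]]_#|{: N}| :=
  \col_i inner (fourier_mode (mode i)) v.

Definition toeplitz (A : 'M[R[i]]_#|{: N}|) : Prop :=
  forall i j i' j', mode i - mode j = mode i' - mode j' -> A i j = A i' j'.

Definition diff_mx (k : 'I_d) : 'M[R[i]]_#|{: N}| :=
  diag_mx (\row_l (0 +i* (mode l 0 k)%:~R)%C).

Definition toeplitz_gen (L : 'M[R[i]]_#|{: N}|) : Prop :=
  exists A : 'I_d -> seq 'M[R[i]]_#|{: N}|,
    (forall k, (0 < size (A k))%N /\ (forall B, B \in A k -> toeplitz B)) /\
    L = \sum_(k < d) (\big[mulmx/1%:M]_(B <- A k) B) *m diff_mx k.
End FiniteModes.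

(* L^2_0: the closure in L^2 of the span of the nonconstant Fourier modes. *)
Definition in_L20 v : Prop :=
  in_L2 v /\
  forall e : R, 0 < e ->
    exists (N : {fset 'rV[int]_d}) (c : 'cV[R[i]]_#|{: N}|),
      (0 \notin N) /\ (L2dist v (Qmap c) <= e%:E)%E.
End L2.

(* The sum converges; the limit is for the norm of ['M[R[i]]_n]. *)
Definition expmx (R : realType) (n : nat) (A : 'M[R[i]]_n) : 'M[R[i]]_n :=
  limn (series (fun k => k`!%:R^-1 *: A ^+ k)).

Section Flow.
Variables (R : realType) (d : nat).
Implicit Types (f : torus R d -> 'rV[R]_d) (g : R -> torus R d -> torus R d).

(* Velocities of curves in the torus are those of their lifts to [R^d]. *)
Definition solution f (x : R -> torus R d) : Prop :=
  exists y : R -> 'rV[R]_d,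
    forall s : R, x s = torus_proj (y s) /\ is_derive s (1 : R) y (f (x s)).

(* [g] is the flow of x' = f(x): [g ^~ x0] is the unique solution starting at
   [x0]. *)
Definition flow_of f g : Prop :=
  forall x0 : torus R d,
    [/\ g 0 x0 = x0, solution f (g ^~ x0) &
        forall x, solution f x -> x 0 = x0 -> forall s, x s = g s x0].

(* The Jacobian is the Jacobian determinant, i.e. the factor in the change of
   variables formula, computed on a lift of [h] to [R^d]. *)
Definition bounded_jacobian (h : torus R d -> torus R d) : Prop :=
  exists H : 'rV[R]_d -> 'rV[R]_d,
    (forall y, h (torus_proj y) = torus_proj (H y)) /\
    (forall y, differentiable H y) /\
    exists M : R, forall y, `|\det (jacobian H y)| <= M.

Definition flow g : Prop :=
  [/\ exists f, flow_of f g,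
      continuous (fun p : R * torus R d => g p.1 p.2) &
      forall t, exists h, [/\ cancel (g t) h, cancel h (g t) &
                              bounded_jacobian h]].

(* [x |-> g_m(t_m, ... g_j(t_j, x))]: the map of index [j] is applied first. *)
Definition flow_comp (g : nat -> R -> torus R d -> torus R d) (t : nat -> R)
    (j m : nat) (x : torus R d) : torus R d :=
  foldl (fun y i => g i (t i) y) x (index_iota j m.+1).
End Flow.

(* Main.v *)
(* Some difference M - m of elements of N is attained only once, so the matrix
   unit E_{M,m} is Toeplitz, and E_{a,b} = T_{a-M} E_{M,m} T_{m-b} is a product
   of three Toeplitz matrices, where T_n has ones at the places of difference n.
   Since b <> 0, multiplying by a suitable D_k shows that s E_{a,b} is in T(N, C)
   for all s. For a <> b its exponential is the transvection 1 + s E_{a,b}, and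
   transvections act transitively on nonzero vectors as soon as |N| > 1. It
   remains to choose N so large that it carries nonzero approximants of all the
   functions v o g_J o ... o g_j, and that the coefficient vector Q_N^* v is not
   zero: if all the modes of an approximant q of v were orthogonal to v, then
   |v| <= |v - q|. By transitivity, the approximants are then hit exactly, one
   after the other. *)

Require Import Defs.
From HB Require Import structures.
From mathcomp Require Import all_boot all_order all_algebra finmap complex generic_quotient.
From mathcomp Require Import zify lra.
From mathcomp Require Import all_classical all_reals all_analysis measurable_realfun.

Import Order.TTheory GRing.Theory Num.Theory.
Import numFieldNormedType.Exports.
Local Open Scope classical_set_scope.
Local Open Scope ring_scope.

(** * Integer frequencies and their inner product *)

Definition int_dot {d : nat} (a b : 'rV[int]_d) : int :=
  \sum_(k < d) a 0 k * b 0 k.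

Lemma int_dotBr {d} (a b c : 'rV[int]_d) :
  int_dot a (b - c) = int_dot a b - int_dot a c.
Proof.
rewrite /int_dot -sumrB; apply: eq_bigr => k _.
by rewrite !mxE mulrBr.
Qed.

Lemma int_dotC {d} (a b : 'rV[int]_d) : int_dot a b = int_dot b a.
Proof. by rewrite /int_dot; apply: eq_bigr => k _; rewrite mulrC. Qed.

Lemma int_dot_ge0 {d} (a : 'rV[int]_d) : 0 <= int_dot a a.
Proof. by apply: sumr_ge0 => k _; rewrite -expr2 sqr_ge0. Qed.

Lemma int_dot_eq0 {d} (a : 'rV[int]_d) : int_dot a a = 0 -> a = 0.
Proof.
move=> /eqP; rewrite psumr_eq0; last by move=> k _; rewrite -expr2 sqr_ge0.
move=> /allP a0; apply/rowP => k; rewrite mxE.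
by have := a0 k (mem_index_enum _); rewrite /= mulf_eq0 orbb => /eqP.
Qed.

Lemma mode_inj {d} (N : {fset 'rV[int]_d}) : injective (mode (N := N)).
Proof. by move=> i j /val_inj /enum_val_inj. Qed.

Lemma mode_in {d} (N : {fset 'rV[int]_d}) (i : 'I_#|{: N}|) : mode i \in N.
Proof. exact: valP. Qed.

Lemma mode_surj {d} (N : {fset 'rV[int]_d}) (n : 'rV[int]_d) :
  n \in N -> exists i : 'I_#|{: N}|, mode i = n.
Proof.
by move=> nN; exists (enum_rank [` nN]%fset); rewrite /mode enum_rankK.
Qed.

(* [M] has maximal norm, and [m] minimises the product with [M]. *)
Lemma unique_difference {d} (N : {fset 'rV[int]_d}) (i0 : 'I_#|{: N}|) :
  exists M m : 'I_#|{: N}|, forall i j,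
    (mode i - mode j == mode M - mode m) = (i == M) && (j == m).
Proof.
pose M := [arg max_(i > i0) int_dot (mode i) (mode i)]%O.
pose m := [arg min_(i < i0) int_dot (mode M) (mode i)]%O.
have maxM (i : 'I_#|{: N}|) :
    int_dot (mode i) (mode i) <= int_dot (mode M) (mode M).
  by rewrite /M; case: arg_maxP => // j _ /(_ i isT).
have minm (i : 'I_#|{: N}|) :
    int_dot (mode M) (mode m) <= int_dot (mode M) (mode i).
  by rewrite /m; case: arg_minP => // j _ /(_ i isT).
exists M, m => i j; apply/eqP/andP; last by case=> /eqP-> /eqP->.
move=> dE; have iM : mode i = mode M.
  apply/eqP; rewrite -subr_eq0; apply/eqP/int_dot_eq0/eqP.
  rewrite eq_le int_dot_ge0 andbT.
  (* Pairing [dE] with [M] gives [i.M >= M.M], by minimality of [M.m]. Together with [i.i <= M.M]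
     this bounds the squared norm of [i - M] by 0. *)
  have := congr1 (int_dot (mode M)) dE; rewrite !int_dotBr.
  have := minm j; have := maxM i.
  rewrite !(int_dotC (mode i - mode M)) !int_dotBr.
  rewrite [int_dot (mode i) (mode M)]int_dotC.
  by move=> h1 h2 h3; lia.
split; apply/eqP; first exact: mode_inj.
by apply: mode_inj; move/eqP: dE; rewrite iM (inj_eq (addrI _)) eqr_opp => /eqP.
Qed.

(** * Matrix units as Toeplitz products and as elements of T(N, C) *)

(** This is the compression to V_N of multiplication by the mode q_n. *)
Definition toeplitz_delta (R : realType) {d} (N : {fset 'rV[int]_d})
    (n : 'rV[int]_d) : 'M[R[i]]_#|{: N}| :=
  \matrix_(i, j) (mode i - mode j == n)%:R.

Lemma toeplitz_deltaP (R : realType) {d} (N : {fset 'rV[int]_d}) n :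
  toeplitz (toeplitz_delta R N n).
Proof. by move=> i j i' j' e; rewrite !mxE e. Qed.

Lemma toeplitzZ {R : realType} {d} {N : {fset 'rV[int]_d}} (s : R[i])
    (A : 'M[R[i]]_#|{: N}|) : toeplitz A -> toeplitz (s *: A).
Proof. by move=> tA i j i' j' e; rewrite !mxE (tA _ _ _ _ e). Qed.

Lemma delta_mx_toeplitz (R : realType) {d} (N : {fset 'rV[int]_d})
    (a b : 'I_#|{: N}|) :
  exists p q r : 'rV[int]_d,
    delta_mx a b =
      toeplitz_delta R N p *m toeplitz_delta R N q *m toeplitz_delta R N r.
Proof.
have [M [m Mm]] := unique_difference N a.
exists (mode a - mode M), (mode M - mode m), (mode m - mode b).
have -> : toeplitz_delta R N (mode M - mode m) = delta_mx M m.
  by apply/matrixP => i j; rewrite !mxE Mm.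
(* Split into a column times a row, the middle factor only sees column [M] of the left factor and
   row [m] of the right one. As modes are distinct, these are the basis column at [a] and the basis
   row at [b]. *)
have -> : delta_mx M m = delta_mx M (0 : 'I_1) *m delta_mx 0 m :> 'M[R[i]]__.
  by rewrite mul_delta_mx.
rewrite mulmxA -colE -mulmxA -rowE.
have -> : col M (toeplitz_delta R N (mode a - mode M)) = delta_mx a 0.
  apply/matrixP => i j; rewrite !mxE ord1 eqxx andbT.
  by rewrite (inj_eq (addIr _)) (inj_eq (@mode_inj _ _)).
have -> : row m (toeplitz_delta R N (mode m - mode b)) = delta_mx 0 b.
  apply/matrixP => i j; rewrite !mxE ord1 eqxx /=.
  by rewrite (inj_eq (addrI _)) eqr_opp (inj_eq (@mode_inj _ _)).
by rewrite mul_delta_mx.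
Qed.

Lemma toeplitz_gen_delta (R : realType) {d} (N : {fset 'rV[int]_d})
    (s : R[i]) (a b : 'I_#|{: N}|) :
  0 \notin N -> toeplitz_gen (s *: delta_mx a b : 'M[R[i]]_#|{: N}|).
Proof.
move=> N0.
have /existsP[k bk] : [exists k, mode b 0 k != 0].
  rewrite -negb_forall; apply: contra N0 => /forallP b0.
  suff <- : mode b = 0 by exact: mode_in.
  by apply/rowP => k; rewrite mxE (eqP (b0 k)).
have [p [q [r abE]]] := delta_mx_toeplitz R N a b.
(* Right multiplication by [diff_mx k] scales the matrix unit by [w], its diagonal entry at [b];
   hence the factor [s / w] below. The other directions get a single zero matrix, since their lists
   must be nonempty. *)
pose w : R[i] := (0 +i* (mode b 0 k)%:~R)%C.
have w0 : w != 0.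
  by rewrite eq_complex /= eqxx intr_eq0.
exists (fun k' => if k' == k then
    [:: (s / w) *: toeplitz_delta R N p; toeplitz_delta R N q;
        toeplitz_delta R N r] else [:: 0]); split.
  move=> k'; case: ifP => _; split => // B; rewrite !inE.
    by case/or3P => /eqP->; [apply: toeplitzZ|..]; exact: toeplitz_deltaP.
  by move=> /eqP-> i j i' j' _; rewrite !mxE.
rewrite (bigD1 k) //= eqxx [X in _ + X]big1 => [|k' /negPf->]; last first.
  by rewrite big_cons !mul0mx.
rewrite addr0 !big_cons big_nil mulmx1 -!scalemxAl mulmxA -abE.
apply/matrixP => i j; rewrite !mxE (bigD1 b) //= big1 => [|l /negPf lb].
  rewrite !mxE addr0 eqxx andbT; case: eqVneq => _ /=; last first.
    by rewrite mul0r !mulr0.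
  by rewrite mul1r -/w [RHS]mulrnAr divfK // eq_sym mulr_natr.
by rewrite !mxE lb andbF mul0r.
Qed.

(** * Exponentials of matrix units, and transitivity of transvections on nonzero vectors *)

(** Off the diagonal a matrix unit squares to zero, so the partial sums of the exponential series
    are constant from the second one on. *)
Lemma expmx_delta {R : realType} {n} (s : R[i]) (a b : 'I_n) :
  a != b -> expmx (s *: delta_mx a b) = 1%:M + s *: delta_mx a b.
Proof.
move=> ab.
have nil : (s *: delta_mx a b) * (s *: delta_mx a b) = 0 :> 'M[R[i]]_n.
  apply: etrans (_ : (s *: delta_mx a b) *m (s *: delta_mx a b) = 0) => //.
  by rewrite -scalemxAl -scalemxAr mul_delta_mx_0 1?eq_sym // !scaler0.
apply: lim_near_cst; first exact: norm_hausdorff.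
near=> m; have m2 : (1 < m)%N by near: m; exists 2%N.
rewrite /series /= -(subnK m2) addn2 big_nat_recl // big_nat_recl //= big1.
  by rewrite fact0 invr1 !scale1r expr0 expr1 addr0.
by move=> k _; rewrite !exprS mulrA nil mul0r scaler0.
Unshelve. all: by end_near.
Qed.

(** The monoid law lets ordered matrix products be split along concatenations. *)
HB.instance Definition _ (R : pzSemiRingType) (n : nat) :=
  Monoid.isLaw.Build 'M[R]_n 1%:M (@mulmx R n n n)
    (@mulmxA R n n n n) (@mul1mx R n n) (@mulmx1 R n n).

(** Nonemptiness of the list is what later makes the indices [J] strictly increasing. *)
Definition reach {R : realType} {d : nat} {N : {fset 'rV[int]_d}}
    (u w : 'cV[R[i]]_#|{: N}|) : Prop :=
  exists s : seq 'M[R[i]]_#|{: N}|,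
    [/\ (0 < size s)%N, forall B, B \in s -> toeplitz_gen B &
        w = (\big[mulmx/1%:M]_(B <- s) expmx B) *m u].

Lemma reach_trans {R : realType} {d : nat} {N : {fset 'rV[int]_d}}
    (u v w : 'cV[R[i]]_#|{: N}|) :
  reach u v -> reach v w -> reach u w.
Proof.
move=> [s [s0 sT ->]] [r [r0 rT ->]]; exists (r ++ s); split.
- by rewrite size_cat ltn_addr.
- by move=> B; rewrite mem_cat => /orP[/rT|/sT].
- by rewrite big_cat mulmxA.
Qed.

(** The transvection [1 + s E_{a,b}] adds [s] times coordinate [b] to coordinate [a]. *)
Lemma reach_transvection {R : realType} {d : nat} {N : {fset 'rV[int]_d}}
    (u : 'cV[R[i]]_#|{: N}|) (s : R[i]) (a b : 'I_#|{: N}|) :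
  0 \notin N -> a != b -> reach u (u + (s * u b 0) *: delta_mx a 0).
Proof.
move=> N0 ab; exists [:: s *: delta_mx a b]; split=> //.
  by move=> B; rewrite inE => /eqP->; exact: toeplitz_gen_delta.
rewrite big_cons big_nil mulmx1 expmx_delta // mulmxDl mul1mx; congr (_ + _).
rewrite -scalemxAl -scalerA; congr (_ *: _).
have -> : delta_mx a b = delta_mx a (0 : 'I_1) *m delta_mx 0 b :> 'M[R[i]]__.
  by rewrite mul_delta_mx.
rewrite -mulmxA -rowE.
have -> : row b u = (u b 0)%:M.
  by apply/matrixP => i j; rewrite !mxE !ord1 eqxx mulr1n.
by rewrite mul_mx_scalar.
Qed.

Lemma ord_neq {n : nat} (b : 'I_n) : (1 < n)%N -> exists a : 'I_n, a != b.
Proof.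
rewrite -[X in (_ < X)%N]card_ord => /card_gt1P[x [y [_ _ xy]]].
by case: (eqVneq x b) => [<-|]; [exists y; rewrite eq_sym | exists x].
Qed.

Lemma reach_pivot {R : realType} {d : nat} {N : {fset 'rV[int]_d}}
    (u w : 'cV[R[i]]_#|{: N}|) (b : 'I_#|{: N}|) :
  0 \notin N -> (1 < #|{: N}|)%N -> u b 0 != 0 -> w b 0 = u b 0 -> reach u w.
Proof.
move=> N0 N1 ub wb.
have [a ab] := ord_neq b N1.
(* Correct the coordinates other than [b] one at a time, using [u b 0 != 0]. *)
suff H (s : seq 'I_#|{: N}|) : b \notin s ->
    reach u (u + \sum_(i <- s) (w i 0 - u i 0) *: delta_mx i 0).
  have := H [seq i <- enum 'I_#|{: N}| | i != b].
  rewrite mem_filter eqxx => /(_ isT); congr reach.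
  rewrite big_filter big_enum_cond /=.
  apply/colP => i; rewrite !mxE summxE.
  have [->|ib] := eqVneq i b.
    rewrite big1 ?addr0 // => j jb.
    by rewrite !mxE eq_sym (negPf jb) mulr0.
  rewrite (bigD1 i) //= big1 => [|j /andP[_ ji]].
    by rewrite !mxE !eqxx mulr1 addr0 addrC subrK.
  by rewrite !mxE eq_sym (negPf ji) mulr0.
elim: s => [_|c s IH].
  rewrite big_nil addr0.
  (* The list of matrices may not be empty, so staying at [u] is realised by the transvection with
     [s = 0]. *)
  by have := reach_transvection u 0 _ _ N0 ab; rewrite mul0r scale0r addr0.
rewrite inE negb_or big_cons => /andP[bc bs].
apply: reach_trans (IH bs) _; set x := u + _.
have xb : x b 0 = u b 0.
  rewrite mxE summxE big_seq big1 ?addr0 // => i si; rewrite !mxE.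
  by case: eqVneq => [bi|]; rewrite ?mulr0 //; rewrite bi si in bs.
rewrite addrCA addrC; rewrite eq_sym in bc.
have := reach_transvection x ((w c 0 - u c 0) / u b 0) _ _ N0 bc.
by rewrite xb divfK.
Qed.

Lemma reach_nonzero {R : realType} {d : nat} {N : {fset 'rV[int]_d}}
    (u w : 'cV[R[i]]_#|{: N}|) :
  0 \notin N -> (1 < #|{: N}|)%N -> u != 0 -> w != 0 -> reach u w.
Proof.
have nz (x : 'cV[R[i]]_#|{: N}|) : x != 0 -> exists b, x b 0 != 0.
  move=> x0; apply/existsP; rewrite -negb_forall; apply: contra x0.
  by move=> /forallP x0; apply/eqP/colP => i; rewrite mxE (eqP (x0 i)).
move=> N0 N1 /nz[b ub] /nz[c wc].
have step (e f : 'I_#|{: N}|) :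
    e != f -> u e 0 != 0 -> w f 0 != 0 -> reach u w.
  move=> ef ue wf.
  (* [x] agrees with [u] at [e] and with [w] elsewhere, in particular at [f]: the first move has
     pivot [e], the second pivot [f]. *)
  pose x : 'cV[R[i]]_#|{: N}| := \col_i if i == e then u e 0 else w i 0.
  apply: (@reach_trans _ _ _ _ x).
    by apply: (reach_pivot _ _ e) => //; rewrite mxE eqxx.
  by apply: (reach_pivot _ _ f) => //; rewrite mxE [f == e]eq_sym (negPf ef).
case: (eqVneq b c) => [bc|]; last by move=> /step; apply.
have [a ab] := ord_neq b N1.
(* With a common pivot [b], all other coordinates are first set to 1. Then [a] serves as pivot while
   coordinate [b] is changed, and [b] again for the rest. *)
pose x : 'cV[R[i]]_#|{: N}| := \col_i if i == b then u b 0 else 1.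
pose y : 'cV[R[i]]_#|{: N}| := \col_i if i == b then w b 0 else 1.
apply: (@reach_trans _ _ _ _ x); last apply: (@reach_trans _ _ _ _ y).
- by apply: (reach_pivot _ _ b) => //; rewrite mxE eqxx.
- by apply: (reach_pivot _ _ a) => //; rewrite !mxE (negPf ab) ?oner_eq0.
- by apply: (reach_pivot _ _ b) => //; rewrite mxE eqxx // bc.
Qed.

(** * The L^2 norm: measurability, integrability and a lower bound for distances *)

Lemma normc_sq {R : realType} (z : R[i]) :
  ComplexField.Normc.normc z ^+ 2 = complex.Re z ^+ 2 + complex.Im z ^+ 2.
Proof. by case: z => a b /=; rewrite sqr_sqrtr // addr_ge0 // sqr_ge0. Qed.

Lemma L2norm_sq {R : realType} {d : nat} (v : torus R d -> R[i]) :
  (L2norm v `^ 2 =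
   \int[torus_measure R d]_x
     (complex.Re (v x) ^+ 2 + complex.Im (v x) ^+ 2)%:E)%E.
Proof.
rewrite /L2norm poweR_Lnorm //; apply: eq_integral => x _ /=.
rewrite ger0_norm; last by case: (v x) => a b; exact: sqrtr_ge0.
by rewrite powR_mulrn ?normc_sq //; case: (v x) => a b; exact: sqrtr_ge0.
Qed.

(** The square root is monotone on [[0, +oo]], so norms can be compared through integrals of squared
    moduli. *)
Lemma L2norm_le {R : realType} {d : nat} (u v : torus R d -> R[i]) :
  (\int[torus_measure R d]_x
     (complex.Re (u x) ^+ 2 + complex.Im (u x) ^+ 2)%:E <=
   \int[torus_measure R d]_x
     (complex.Re (v x) ^+ 2 + complex.Im (v x) ^+ 2)%:E)%E ->
  (L2norm u <= L2norm v)%E.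
Proof.
rewrite -!L2norm_sq => uv.
have sqrK (a : \bar R) : (0 <= a)%E -> ((a `^ 2) `^ 2^-1 = a)%E.
  by move=> a0; rewrite -poweRrM mulfV ?poweRe1.
rewrite -(sqrK (L2norm u)) ?Lnorm_ge0 // -(sqrK (L2norm v)) ?Lnorm_ge0 //.
by apply: gt0_ler_poweR => //; rewrite in_itv /= leey poweR_ge0.
Qed.

(** The torus carries the quotient sigma-algebra, so measurability can be tested on R^d. *)
Lemma measurable_fun_torus {R : realType} {d : nat} (f : torus R d -> R) :
  measurable_fun setT (f \o @torus_of_tuple R d) -> measurable_fun setT f.
Proof.
move=> mf _ Y mY; have := mf measurableT Y mY.
by rewrite !setTI.
Qed.

Lemma measurable_fourier_mode (R : realType) {d : nat} (n : 'rV[int]_d) :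
  measurable_fun setT (fun x : torus R d => complex.Re (fourier_mode n x)) /\
  measurable_fun setT (fun x : torus R d => complex.Im (fourier_mode n x)).
Proof.
pose th (y : d.-tuple (measurableTypeR R)) : R :=
  \sum_(k < d) (n 0 k)%:~R * tnth y k.
have mth : measurable_fun setT th.
  apply: measurable_sum => k; apply: measurable_funM => //.
  exact: measurable_tnth.
have E y : fourier_mode n (torus_of_tuple y) = (cos (th y) +i* sin (th y))%C.
  rewrite /torus_of_tuple fourier_modeE /th.
  by congr (cos _ +i* sin _)%C; apply: eq_bigr => k _; rewrite mxE.
split; apply: measurable_fun_torus.
- rewrite (_ : _ \o _ = @cos R \o th).
  2: by apply/funext => y; rewrite [LHS]/comp E.
  apply: measurableT_comp => //.
  exact: (continuous_measurable_fun (@continuous_cos R)).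
- rewrite (_ : _ \o _ = @sin R \o th).
  2: by apply/funext => y; rewrite [LHS]/comp E.
  apply: measurableT_comp => //.
  exact: (continuous_measurable_fun (@continuous_sin R)).
Qed.

Lemma measurable_Qmap {R : realType} {d : nat} {N : {fset 'rV[int]_d}}
    (c : 'cV[R[i]]_#|{: N}|) :
  measurable_fun setT (fun x => complex.Re (Qmap c x)) /\
  measurable_fun setT (fun x => complex.Im (Qmap c x)).
Proof.
have ReE x : complex.Re (Qmap c x) = \sum_i
    (complex.Re (c i 0) * complex.Re (fourier_mode (mode i) x) -
     complex.Im (c i 0) * complex.Im (fourier_mode (mode i) x)).
  rewrite /Qmap raddf_sum; apply: eq_bigr => i _.
  by case: (c i 0); case: fourier_mode.
have ImE x : complex.Im (Qmap c x) = \sum_i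
    (complex.Re (c i 0) * complex.Im (fourier_mode (mode i) x) +
     complex.Im (c i 0) * complex.Re (fourier_mode (mode i) x)).
  rewrite /Qmap raddf_sum; apply: eq_bigr => i _.
  by case: (c i 0); case: fourier_mode.
split; [under eq_fun do rewrite ReE|under eq_fun do rewrite ImE];
  apply: measurable_sum => i;
  have [mR mI] := measurable_fourier_mode R (mode i).
- by apply: measurable_funB; apply: measurable_funM.
- by apply: measurable_funD; apply: measurable_funM.
Qed.

Lemma L2norm_fin_integrable {R : realType} {d : nat} (v : torus R d -> R[i]) :
  in_L2 v -> (torus_measure R d).-integrable setT
    (EFin \o (fun x => complex.Re (v x) ^+ 2 + complex.Im (v x) ^+ 2)).
Proof.
move=> [mR mI vfin]; apply/integrableP; split.
  by apply/measurable_EFinP/measurable_funD; apply: measurable_funX.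
under eq_integral => x _ do
  rewrite /= ger0_norm ?addr_ge0 ?sqr_ge0//.
by rewrite -L2norm_sq poweR_lty.
Qed.

(** Modes have modulus 1, so both parts are dominated by [1 + |v|^2], which is integrable because
    the measure is finite. *)
Lemma integrable_inner {R : realType} {d : nat} (v : torus R d -> R[i]) n :
  in_L2 v ->
  (torus_measure R d).-integrable setT
    (EFin \o (fun x => complex.Re (conjc (fourier_mode n x) * v x))) /\
  (torus_measure R d).-integrable setT
    (EFin \o (fun x => complex.Im (conjc (fourier_mode n x) * v x))).
Proof.
move=> vL2; have [mR mI _] := vL2.
have [mc ms] := measurable_fourier_mode R n.
pose g x := 1 + (complex.Re (v x) ^+ 2 + complex.Im (v x) ^+ 2).
have ig : (torus_measure R d).-integrable setT (EFin \o g).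
  exact: integrableD (finite_measure_integrable_cst _ 1 measurableT)
    (L2norm_fin_integrable _ vL2).
have b (a c s t : R) : a ^+ 2 + c ^+ 2 = 1 ->
    `|a * s + c * t| <= `|1 + (s ^+ 2 + t ^+ 2)|.
  move=> ac; have g0 : 0 <= 1 + (s ^+ 2 + t ^+ 2).
    by rewrite !addr_ge0 ?sqr_ge0.
  rewrite (ger0_norm g0) ler_norml.
  (* Summing the squares of [a - s] and [c - t], or of [a + s] and [c + t], bounds [a s + c t] from
     either side. *)
  have := sqr_ge0 (a - s); have := sqr_ge0 (c - t).
  have := sqr_ge0 (a + s); have := sqr_ge0 (c + t).
  by move=> h1 h2 h3 h4; apply/andP; split; nra.
have cs x : complex.Re (fourier_mode n x) ^+ 2 +
    complex.Im (fourier_mode n x) ^+ 2 = 1 :> R by exact: cos2Dsin2.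
have RE (x : torus R d) : complex.Re (conjc (fourier_mode n x) * v x) =
    complex.Re (fourier_mode n x) * complex.Re (v x) +
    complex.Im (fourier_mode n x) * complex.Im (v x).
  case: (v x) => p q /=; case: (fourier_mode n x) => ? ? /=.
  by rewrite mulNr opprK.
have IE (x : torus R d) : complex.Im (conjc (fourier_mode n x) * v x) =
    complex.Re (fourier_mode n x) * complex.Im (v x) +
    - complex.Im (fourier_mode n x) * complex.Re (v x).
  by case: (v x) => p q /=; case: (fourier_mode n x).
split; (apply: (le_integrable _ _ _ ig) => //; [
  apply/measurable_EFinP | move=> x _ /=; rewrite lee_fin]).
- under eq_fun do rewrite RE.
  by apply: measurable_funD; apply: measurable_funM.
- by rewrite RE; apply: b.
- under eq_fun do rewrite IE.
  apply: measurable_funD; apply: measurable_funM => //.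
  exact: measurableT_comp.
- by rewrite IE /g [X in 1 + X]addrC; apply: b; rewrite sqrrN.
Qed.

Lemma integrable_scale {d} {T : measurableType d} {R : realType}
    {mu : {measure set T -> \bar R}} (a : R) (f : T -> R) :
  mu.-integrable setT (EFin \o f) ->
  mu.-integrable setT (EFin \o (fun x => a * f x)).
Proof. by move=> fi; exact: (integrableZl measurableT a fi). Qed.

Lemma integrable_lincomb {d} {T : measurableType d} {R : realType}
    {mu : {measure set T -> \bar R}} (a b : R) (f g : T -> R) :
  mu.-integrable setT (EFin \o f) -> mu.-integrable setT (EFin \o g) ->
  mu.-integrable setT (EFin \o (fun x => a * f x + b * g x)).
Proof.
move=> fi gi.
exact: (integrableD measurableT (integrable_scale a f fi)
  (integrable_scale b g gi)).
Qed.

Lemma Rintegral_sum {d} {T : measurableType d} {R : realType}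
    {mu : {measure set T -> \bar R}} {I : Type} (s : seq I) (f : I -> T -> R) :
  (forall i, mu.-integrable setT (EFin \o f i)) ->
  (mu.-integrable setT (EFin \o (fun x => \sum_(i <- s) f i x)) /\
   \int[mu]_x (\sum_(i <- s) f i x) = \sum_(i <- s) \int[mu]_x f i x)%R.
Proof.
move=> fi; elim: s => [|i s [IHi IH]].
  rewrite big_nil; have -> : (fun x => \sum_(i <- [::]) f i x) = cst 0.
    by apply/funext => x; rewrite big_nil.
  by split; [exact: integrable0 | rewrite /Rintegral integral0].
have -> : (fun x => \sum_(j <- i :: s) f j x) =
    (fun x => f i x + \sum_(j <- s) f j x).
  by apply/funext => x; rewrite big_cons.
split; first exact: integrableD (fi i) IHi.
by rewrite big_cons RintegralD // IH.
Qed.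

(* Integrate [|v|^2 - 2 Re (conj (Qmap c) v) <= |v - Qmap c|^2]; the hypothesis
   says that the middle term has integral [0]. *)
Lemma L2dist_ge {R : realType} {d : nat} {N : {fset 'rV[int]_d}}
    (v : torus R d -> R[i]) (c : 'cV[R[i]]_#|{: N}|) :
  in_L2 v -> \sum_i conjc (c i 0) * Qadj N v i 0 = 0 ->
  (L2norm v <= L2dist v (Qmap c))%E.
Proof.
move=> vL2 cv0; set mu := torus_measure R d.
have [mR mI _] := vL2; have [mqR mqI] := measurable_Qmap c.
have [vqfin|/negP] := pselect (L2dist v (Qmap c) < +oo)%E; last first.
  by rewrite -leNgt => /(le_trans _); apply; rewrite leey.
have vqL2 : in_L2 (fun x => v x - Qmap c x).
  split=> //.
  - have -> : (fun x => complex.Re (v x - Qmap c x)) =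
        (fun x => complex.Re (v x) - complex.Re (Qmap c x)).
      by apply/funext => x; rewrite raddfB.
    exact: measurable_funB.
  - have -> : (fun x => complex.Im (v x - Qmap c x)) =
        (fun x => complex.Im (v x) - complex.Im (Qmap c x)).
      by apply/funext => x; rewrite raddfB.
    exact: measurable_funB.
pose w (i : 'I_#|{: N}|) x := conjc (fourier_mode (mode i) x) * v x.
have iw (i : 'I_#|{: N}|) := integrable_inner v (mode i) vL2.
(* [r i] is the real part of [conj (c i) * w i], so that [\sum_i r i] is the real part of
   [conj (Qmap c) * v]. *)
pose r (i : 'I_#|{: N}|) x := complex.Re (c i 0) * complex.Re (w i x) +
  complex.Im (c i 0) * complex.Im (w i x).
have ir i : mu.-integrable setT (EFin \o r i).
  have [iR iI] := iw i.
  exact: integrable_lincomb.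
have [isr sr] := Rintegral_sum (index_enum _) r ir.
have sr0 : (\int[mu]_x (\sum_i r i x) = 0)%R.
  transitivity (complex.Re (\sum_i conjc (c i 0) * Qadj N v i 0)).
    2: by rewrite cv0.
  rewrite sr raddf_sum; apply: eq_bigr => i _ /=.
  have [iR iI] := iw i.
  rewrite /r RintegralD //; [|exact: integrable_scale..].
  rewrite !RintegralZl // mxE /inner; case: (c i 0) => a b /=.
  by rewrite mulNr opprK.
have rE x : \sum_i r i x = complex.Re (conjc (Qmap c x) * v x).
  rewrite /Qmap rmorph_sum mulr_suml raddf_sum; apply: eq_bigr => i _.
  rewrite rmorphM -mulrA -/(w i x) /r.
  by case: (c i 0) (w i x) => a b [p q] /=; rewrite mulNr opprK.
apply: L2norm_le.
pose h x := complex.Re (v x) ^+ 2 + complex.Im (v x) ^+ 2 + (-2) * \sum_i r i x.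
have iv := L2norm_fin_integrable v vL2.
have i2 : mu.-integrable setT (EFin \o (fun x => (-2) * \sum_i r i x)).
  exact: integrable_scale.
apply: (@le_trans _ _ (\int[mu]_x (h x)%:E)%E).
  rewrite /h; under [leRHS]eq_integral => x _ do rewrite EFinD.
  rewrite integralD // -[X in (_ <= _ + X)%E]fineK.
    2: exact: integrable_fin_num.
  have := RintegralZl (-2) measurableT isr; rewrite sr0 mulr0 /Rintegral => ->.
  by rewrite adde0.
(* Pointwise, [|v - Qmap c|^2 - h] equals [|Qmap c|^2]. *)
apply: le_integral => //.
- exact: integrableD iv i2.
- exact: L2norm_fin_integrable.
move=> x _; rewrite lee_fin /h rE.
case: (v x) (Qmap c x) => a b [p q] /=.
by have := sqr_ge0 p; have := sqr_ge0 q; nra.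
Qed.

Lemma L2norm_gt0 {R : realType} {d : nat} (v : torus R d -> R[i]) :
  in_L2 v -> ~ zero_in_L2 v -> (0 < L2norm v)%E.
Proof.
move=> [mR mI _] v0; rewrite lt_neqAle Lnorm_ge0 andbT.
apply/eqP => /esym v0E; apply: v0.
have mv : measurable_fun setT
    (EFin \o (fun x => ComplexField.Normc.normc (v x))).
  apply/measurable_EFinP.
  have -> : (fun x => ComplexField.Normc.normc (v x)) =
      Num.sqrt \o (fun x => complex.Re (v x) ^+ 2 + complex.Im (v x) ^+ 2).
    by apply/funext => x /=; case: (v x).
  apply: measurableT_comp.
    exact: (continuous_measurable_fun (@sqrt_continuous R)).
  by apply: measurable_funD; apply: measurable_funX.
have /= [A [mA A0 Av]] := Lnorm_eq0_eq0 mv (ltr0Sn _ 1 : (0 < 2%:E)%E) v0E.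
exists A; split=> // x vx; apply: Av => /= vx0; apply: vx.
by have [] := vx0 I => /ComplexField.Normc.eq0_normc.
Qed.

(** * Nonzero approximants and enlargement of the set of frequencies *)

Lemma approx_nonzero {R : realType} {d : nat} (v : torus R d -> R[i]) (e : R) :
  in_L20 v -> ~ zero_in_L2 v -> 0 < e ->
  exists (N : {fset 'rV[int]_d}) (c : 'cV[R[i]]_#|{: N}|),
    [/\ 0 \notin N, (L2dist v (Qmap c) <= e%:E)%E, c != 0 & Qadj N v != 0].
Proof.
move=> [vL2 vcl] v0 e0; have vgt0 := L2norm_gt0 v vL2 v0.
have vfin : L2norm v \is a fin_num.
  by rewrite ge0_fin_numE ?Lnorm_ge0 //; case: vL2.
have f0 : 0 < fine (L2norm v) by rewrite -lte_fin fineK.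
(* The bound [e] gives the accuracy; half the norm makes the distance strictly less than the norm of
   [v], so that [L2dist_ge] rules out [c = 0] and [Qadj N v = 0]. *)
have /vcl[N [c [N0 cN]]] : 0 < Num.min e (fine (L2norm v) / 2).
  by rewrite lt_min e0 divr_gt0.
have ltv : (L2dist v (Qmap c) < L2norm v)%E.
  apply: le_lt_trans cN _.
  rewrite -[ltRHS]fineK // lte_fin gt_min; apply/orP; right.
  by lra.
have nz : \sum_i conjc (c i 0) * Qadj N v i 0 <> 0.
  by move=> /(L2dist_ge _ _ vL2); rewrite leNgt ltv.
exists N, c; split=> //.
- by apply: le_trans cN _; rewrite lee_fin ge_min lexx.
- apply/eqP => c0; apply: nz; rewrite big1 // => i _.
  by rewrite c0 mxE conjc0 mul0r.
- by apply/eqP => c0; apply: nz; rewrite big1 // => i _; rewrite c0 mxE mulr0.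
Qed.

(** The coefficients are padded with zeros; the injection [f] translates the numbering of [N] into
    that of [N']. *)
Lemma Qmap_widen {R : realType} {d : nat} {N N' : {fset 'rV[int]_d}}
    (c : 'cV[R[i]]_#|{: N}|) : (N `<=` N')%fset -> c != 0 ->
  exists2 c' : 'cV[R[i]]_#|{: N'}|, c' != 0 & Qmap c' = Qmap c.
Proof.
move=> NN' c0.
have /choice[f fE] (i : 'I_#|{: N}|) : exists j : 'I_#|{: N'}|, mode j = mode i.
  by apply: mode_surj; apply: (fsubsetP NN'); exact: mode_in.
have finj : injective f.
  by move=> i j ij; apply: mode_inj; rewrite -!fE ij.
exists (\sum_i c i 0 *: delta_mx (f i) 0).
  apply: contra c0 => /eqP c'0; apply/eqP/colP => i; rewrite mxE.
  have := congr1 (fun M : 'cV_ _ => M (f i) 0) c'0.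
  rewrite !mxE summxE (bigD1 i) //= big1 => [|j ji].
    by rewrite !mxE !eqxx mulr1 addr0.
  by rewrite !mxE (inj_eq finj) eq_sym (negPf ji) mulr0.
apply/funext => x; rewrite /Qmap.
under eq_bigr do rewrite summxE mulr_suml.
rewrite exchange_big /=; apply: eq_bigr => i _.
rewrite (bigD1 (f i)) //= big1 => [|j ji].
  by rewrite !mxE !eqxx mulr1 addr0 fE.
by rewrite !mxE (negPf ji) mulr0 mul0r.
Qed.

Lemma Qadj_widen {R : realType} {d : nat} {N N' : {fset 'rV[int]_d}}
    (v : torus R d -> R[i]) :
  (N `<=` N')%fset -> Qadj N v != 0 -> Qadj N' v != 0.
Proof.
move=> NN'; apply: contra => /eqP v0; apply/eqP/colP => i; rewrite !mxE.
have [j <-] : exists j : 'I_#|{: N'}|, mode j = mode i.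
  by apply: mode_surj; apply: (fsubsetP NN'); exact: mode_in.
by have := congr1 (fun M : 'cV_ _ => M j 0) v0; rewrite !mxE.
Qed.

(** * From a chain of reachable vectors to one numbered family of matrices *)

(** Matrices are numbered from 1 and list entries from 0, hence [i.-1]. *)
Lemma big_nat_drop {T S : Type} (op : S -> S -> S) (idx : S) (x0 : T)
    (s : seq T) (F : T -> S) (m : nat) :
  \big[op/idx]_(m.+1 <= i < (size s).+1) F (nth x0 s i.-1) =
  \big[op/idx]_(x <- drop m s) F x.
Proof.
rewrite big_add1 /= -{1}[m]add0n big_addn [RHS](big_nth x0) size_drop.
by apply: eq_bigr => i _; rewrite nth_drop addnC.
Qed.

(** The lists leading from [c j.+1] to [c j] are concatenated for j = 1, ..., n, and [J j] is the
    total length of the first j. The factors after [J j.-1] form the lists j, ..., n; as the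
    rightmost acts first, they carry [c n.+1] down to [c j]. *)
Lemma reach_chain {R : realType} {d : nat} {N : {fset 'rV[int]_d}} (n : nat)
    (c : nat -> 'cV[R[i]]_#|{: N}|) :
  (forall j, (1 <= j <= n)%N -> reach (c j.+1) (c j)) ->
  exists (J : nat -> nat) (L : nat -> 'M[R[i]]_#|{: N}|),
    [/\ J 0%N = 0%N,
        (forall j, (j < n)%N -> (J j < J j.+1)%N),
        (forall i, (1 <= i <= J n)%N -> toeplitz_gen (L i)) &
        forall j, (1 <= j <= n)%N ->
          (\big[mulmx/1%:M]_((J j.-1).+1 <= i < (J n).+1) expmx (L i))
            *m c n.+1 = c j].
Proof.
move=> cR.
have /choice[s sP] (j : nat) : exists s : seq 'M[R[i]]_#|{: N}|,
    (1 <= j <= n)%N -> [/\ (0 < size s)%N, forall B, B \in s -> toeplitz_gen B &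
      c j = (\big[mulmx/1%:M]_(B <- s) expmx B) *m c j.+1].
  have [/cR[s]|] := boolP (1 <= j <= n)%N; first by exists s.
  by exists [::].
pose F (m k : nat) := flatten [seq s i | i <- iota m k].
have FD m k l : F m (k + l)%N = F m k ++ F (m + k)%N l.
  by rewrite /F iotaD map_cat flatten_cat.
exists (fun j => size (F 1 j)), (fun i => nth 0 (F 1 n) i.-1); split=> //.
- move=> j jn; rewrite -[j.+1]addn1 FD size_cat -{1}[size (F 1 j)]addn0.
  rewrite ltn_add2l /F /= cats0 add1n.
  by have [] := sP j.+1 jn.
- move=> i /andP[i0 iF].
  have /flattenP[_ /mapP[j + ->]] : nth 0 (F 1 n) i.-1 \in F 1 n.
    by apply: mem_nth; rewrite prednK.
  by rewrite mem_iota add1n ltnS => /sP[_ sT _] /sT.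
- case=> // j /= jn; rewrite big_nat_drop.
  have -> : drop (size (F 1 j)) (F 1 n) = F j.+1 (n - j)%N.
    by rewrite -{1}(subnKC (ltnW jn)) FD drop_size_cat // add1n.
  (* Induction on the number [k] of remaining lists, splitting off the leftmost, which acts last. *)
  suff H k : forall i, (i.+1 + k = n.+1)%N ->
      (\big[mulmx/1%:M]_(B <- F i.+1 k) expmx B) *m c n.+1 = c i.+1.
    by apply: H; rewrite addSn subnKC // ltnW.
  elim: k => [|k IH] i; first by rewrite addn0 /F big_nil mul1mx => <-.
  rewrite addnS => -[ikn]; rewrite /F /= big_cat /= -mulmxA.
  rewrite -/(F i.+2 k) IH; last by rewrite addSn ikn.
  have iI : (1 <= i.+1 <= n)%N by rewrite /= -ikn addSn ltnS leq_addr.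
  by have [_ _ <-] := sP _ iI.
Qed.

(** * Simultaneous approximation of all the compositions *)

Theorem corollary7 (R : realType) (d Jt : nat) (v : torus R d -> R[i])
    (g : nat -> R -> torus R d -> torus R d) (t : nat -> R) (eps : R) :
  (1 <= d)%N -> (1 <= Jt)%N ->
  in_L20 v -> ~ zero_in_L2 v ->
  (forall j, (1 <= j <= Jt)%N -> flow (g j)) ->
  (forall j, (1 <= j <= Jt)%N ->
     in_L20 (v \o flow_comp g t j Jt) /\
     ~ zero_in_L2 (v \o flow_comp g t j Jt)) ->
  0 < eps ->
  exists N : {fset 'rV[int]_d},
    (0 \notin N) /\
    exists (J : nat -> nat) (L : nat -> 'M[R[i]]_#|{: N}|),
      [/\ J 0%N = 0%N,
          (forall j, (j < Jt)%N -> (J j < J j.+1)%N),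
          (forall i, (1 <= i <= J Jt)%N -> toeplitz_gen (L i)) &
          forall j, (1 <= j <= Jt)%N ->
            (L2dist (v \o flow_comp g t j Jt)
               (Qmap ((\big[mulmx/1%:M]_((J j.-1).+1 <= i < (J Jt).+1) expmx (L i))
                  *m Qadj N v)%R) <= eps%:E)%E].
Proof.
move=> d0 _ vL20 v0 _ wP eps0.
(* The accuracy 1 is arbitrary: only the nonvanishing of [Qadj Nv v] is kept. *)
have [Nv [_ [Nv0 _ _ Qv0]]] := approx_nonzero v 1 vL20 v0 ltr01.
have /choice[M MP] (j : nat) : exists M : {fset 'rV[int]_d},
    0 \notin M /\ ((1 <= j <= Jt)%N -> exists2 c : 'cV[R[i]]_#|{: M}|,
      c != 0 & (L2dist (v \o flow_comp g t j Jt) (Qmap c) <= eps%:E)%E).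
  have [/wP[wL20 w0]|] := boolP (1 <= j <= Jt)%N; last by exists fset0.
  have [M [c [M0 cw c0 _]]] := approx_nonzero _ _ wL20 w0 eps0.
  by exists M; split=> // _; exists c.
(* The constant vectors [e 1] and [e 2] are distinct and nonzero because [d >= 1]; adding them to
   [N] ensures the two coordinates that transitivity requires. *)
pose e (z : int) : 'rV[int]_d := const_mx z.
have einj : injective e.
  by move=> x y /(congr1 (fun A : 'rV_d => A 0 (Ordinal d0))); rewrite !mxE.
pose N := (\bigcup_(j <- iota 1 Jt) M j `|` (Nv `|` [fset e 1%R; e 2%R]))%fset.
exists N.
have N0 : 0 \notin N.
  have e0 : e 0 = 0 by apply/rowP => k; rewrite !mxE.
  rewrite !inE (negPf Nv0) -e0 !(inj_eq einj) !orbF e0.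
  by apply/bigfcupP => -[j _]; rewrite (negPf (MP j).1).
split=> //.
have N1 : (1 < #|{: N}|)%N.
  rewrite -cardfE; apply: leq_trans (_ : (#|` [fset e 1%R; e 2%R]%fset| <= _)%N).
    by rewrite cardfs2 (inj_eq einj).
  apply/fsubset_leq_card/fsubsetP => n ne.
  by rewrite in_fsetU [X in _ || X]in_fsetU ne !orbT.
have /choice[c cP] (j : nat) : exists c : 'cV[R[i]]_#|{: N}|,
    (1 <= j <= Jt)%N -> c != 0 /\ (L2dist (v \o flow_comp g t j Jt) (Qmap c) <= eps%:E)%E.
  have [jJ|] := boolP (1 <= j <= Jt)%N; last by exists 0.
  have [c c0 cw] := (MP j).2 jJ.
  have MN : (M j `<=` N)%fset.
    apply: fsubsetU; apply/orP; left.
    by apply: bigfcup_sup => //; rewrite mem_iota add1n ltnS.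
  have [c' c'0 cE] := Qmap_widen c MN c0.
  by exists c'; rewrite cE.
have Q0 : Qadj N v != 0.
  apply: Qadj_widen Qv0; apply/fsubsetP => n nv.
  by rewrite /N !in_fsetU nv orbT.
(* The chain starts at index [Jt.+1] with [Qadj N v] and descends through the approximants to index
   1. *)
pose c' j := if j == Jt.+1 then Qadj N v else c j.
have cE j : (j <= Jt)%N -> c' j = c j.
  by move=> jJ; rewrite /c' ltn_eqF.
have [|J [L [J0 Jlt LT JL]]] := reach_chain Jt c'.
  move=> j jJ; have /andP[j1 jJt] := jJ; apply: reach_nonzero => //.
    have [->|jn] := eqVneq j Jt; first by rewrite /c' eqxx.
    have jlt : (j < Jt)%N by rewrite ltn_neqAle jn.
    by rewrite cE //; have [] := cP j.+1 jlt.
  by rewrite cE //; have [] := cP j jJ.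
exists J, L; split=> // j jJ; have /andP[_ jJt] := jJ.
have := JL j jJ; rewrite (cE j) // {1}/c' eqxx => ->.
by have [] := cP j jJ.
Qed.
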